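(* There exists an absolute constant $c>0$ such that the following holds for every integer $T\ge1$. For any OLO algorithm and any $1$-Lipschitz function $h:\mathbb{R}\to\mathbb{R}$, there exists a Boolean adversary (that is, one with $g_t\in\{-1,1\}$ for all $t\in\{1,\dots,T\}$) inducing $$\sum_{t=1}^Tg_tx_t> -h\Big(\sum_{t=1}^Tg_t\Big)+\mathbb{E}_{Z\sim\mathcal{N}(0,1)}[h(\sqrt{T}Z)]-c.$$
   Context: Online linear optimization (OLO) game with horizon $T$: an OLO algorithm is a sequence of functions $a_t:\mathbb{R}^{t-1}\to[-1,1]$, $t=1,\dots,T$ (which may depend on $T$), and an adversary is a sequence of functions $l_t:\mathbb{R}^{t}\to\mathbb{R}$ (which may depend on $T$ and on the algorithm). In round $t$ the algorithm plays $x_t=a_t(g_1,\dots,g_{t-1})$, then the adversary plays $g_t=l_t(x_1,\dots,x_t)$. *)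

(* Defs.v *)
From HB Require Import structures.
From mathcomp Require Import all_boot all_order all_algebra.
From mathcomp Require Import all_classical all_reals all_analysis.

Set Implicit Arguments.
Unset Strict Implicit.
Unset Printing Implicit Defensive.

Import Order.TTheory GRing.Theory Num.Theory.
Import numFieldNormedType.Exports.

Local Open Scope ring_scope.

(* Rounds are numbered from 0: the index t : 'I_T stands for round t + 1, which
   is preceded by exactly t rounds. *)

Record olo_algorithm (R : realType) (T : nat) := OloAlgorithm {
  alg_move :> forall t : 'I_T, t.-tuple R -> R;
  alg_move_bounded : forall (t : 'I_T) (g : t.-tuple R),
    -1 <= alg_move g <= 1
}.

Definition adversary (R : realType) (T : nat) : Type :=
  forall t : 'I_T, t.+1.-tuple R -> R.

(* The pair (x_1, ..., x_n), (g_1, ..., g_n) of the moves made by the algorithm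
   and by the adversary in the first n rounds. *)
Fixpoint play (R : realType) (T : nat) (a : olo_algorithm R T)
    (l : adversary R T) (n : nat) : (n <= T)%N -> n.-tuple R * n.-tuple R :=
  match n with
  | 0 => fun _ => ([tuple], [tuple])
  | m.+1 => fun ltmT : (m < T)%N =>
      let: (x, g) := play a l (ltnW ltmT) in
      let t := Ordinal ltmT in
      let x' := [tuple of rcons x (a t g)] in
      (x', [tuple of rcons g (l t x')])
  end.

Definition alg_moves (R : realType) (T : nat) (a : olo_algorithm R T)
    (l : adversary R T) : T.-tuple R := (play a l (leqnn T)).1.

Definition adv_moves (R : realType) (T : nat) (a : olo_algorithm R T)
    (l : adversary R T) : T.-tuple R := (play a l (leqnn T)).2.

(* Main.v *)
Require Import Defs.
From HB Require Import structures.
From mathcomp Require Import all_boot all_order all_algebra.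
From mathcomp Require Import all_classical all_reals all_analysis.
From mathcomp Require Import measurable_realfun ring lra.

Set Implicit Arguments.
Unset Strict Implicit.
Unset Printing Implicit Defensive.

Import Order.TTheory GRing.Theory Num.Theory.
Import numFieldNormedType.Exports.

Local Open Scope classical_set_scope.
Local Open Scope ring_scope.

(* Let V n s = E h(s + sqrt n Z). When the moves so far sum to s and n + 1 rounds
   remain, for every function W some sign g satisfies
     g x + W n (s + g) >= (W n (s + 1) + W n (s - 1)) / 2
   whatever x the algorithm played, so it suffices to correct V by a bounded
   amount into a potential W whose right-hand side above is at least W (n+1) s.
   For V itself this holds up to O(n^(-3/2)): the mean of the N(s +- 1, n)
   densities and the N(s, n + 1) density have the same mass, mean and variance,
   and |y - s| times their difference is O(n^(-3/2)) times the N(s, 4n) density.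
   As n^(-3/2) is summable, a correction of order n^(-1/2) absorbs the errors. *)

(** * The greedy adversary driven by an arbitrary potential [W] *)

Section Game.
Variables (R : realType) (T : nat) (a : olo_algorithm R T).
Variable W : nat -> R -> R.

(** Here [m] rounds are over, so [T - m] remain before the sign is chosen and [T - m.+1] after
    it. *)
Definition greedy_sign (m : nat) (x s : R) : R :=
  if W (T - m) s <= x + W (T - m.+1) (s + 1) then 1 else -1.

(** An adversary is shown only the moves of the algorithm, while the greedy rule needs the past
    signs. As the algorithm is deterministic, these can be replayed from [a] alone. *)
Fixpoint greedy_moves (n : nat) : (n <= T)%N -> n.-tuple R :=
  match n with
  | 0 => fun=> [tuple]
  | m.+1 => fun ltmT : (m < T)%N =>
      let g := greedy_moves (ltnW ltmT) in
      [tuple of rcons g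
        (greedy_sign m (a (Ordinal ltmT) g) (\sum_(i < m) tnth g i))]
  end.

Definition greedy_adversary : adversary R T := fun t _ =>
  let g := greedy_moves (ltnW (ltn_ord t)) in
  greedy_sign t (a t g) (\sum_(i < t) tnth g i).

Lemma play_greedy_adversary n (lenT : (n <= T)%N) :
  (play a greedy_adversary lenT).2 = greedy_moves lenT.
Proof.
elim: n lenT => [//|m IH] ltmT /=.
move: (IH (ltnW ltmT)); case: (play _ _ _) => x g /= ->.
apply: val_inj => /=; rewrite /greedy_adversary /=.
by have -> : ltnW (ltn_ord (Ordinal ltmT)) = ltnW ltmT by [].
Qed.

Lemma sum_tnth_rcons (S : nmodType) n (F : R -> R -> S) (x g : n.-tuple R)
    (x' g' : R) :
  \sum_(i < n.+1) F (tnth [tuple of rcons g g'] i) (tnth [tuple of rcons x x'] i)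
  = \sum_(i < n) F (tnth g i) (tnth x i) + F g' x'.
Proof.
rewrite big_ord_recr /=; congr (_ + F _ _); last first.
- by rewrite (tnth_nth 0) /= nth_rcons size_tuple ltnn eqxx.
- by rewrite (tnth_nth 0) /= nth_rcons size_tuple ltnn eqxx.
apply: eq_bigr => i _; congr F;
  by rewrite !(tnth_nth 0) /= nth_rcons size_tuple ltn_ord.
Qed.

Hypothesis W_step : forall n s, (n < T)%N ->
  W n.+1 s <= (W n (s + 1) + W n (s - 1)) / 2.

(** Invariant of the play: the payoff so far plus the potential of the remaining rounds never
    decreases. *)
Lemma greedy_moves_potential n (lenT : (n <= T)%N) :
  let x := (play a greedy_adversary lenT).1 in
  let g := (play a greedy_adversary lenT).2 in
  (forall t : 'I_n, tnth g t = -1 \/ tnth g t = 1) /\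
  W T 0 <= \sum_(t < n) tnth g t * tnth x t + W (T - n) (\sum_(t < n) tnth g t).
Proof.
elim: n lenT => [|m IH] ltmT /=.
  by split=> [[]//|]; rewrite !big_ord0 add0r subn0.
have := IH (ltnW ltmT); have := play_greedy_adversary (ltnW ltmT).
case: (play _ _ _) => x g /= gE [g1 IHW].
set y := a (Ordinal ltmT) g; set s := \sum_(i < m) tnth g i.
have moveE z : greedy_adversary (t := Ordinal ltmT) z = greedy_sign m y s.
  rewrite /greedy_adversary /=.
  by have -> : ltnW (ltn_ord (Ordinal ltmT)) = ltnW ltmT by []; rewrite -gE.
rewrite moveE.
have TmE : (T - m = (T - m.+1).+1)%N by rewrite subnSK.
have Wm := @W_step (T - m.+1) s.
rewrite -TmE leq_subr /= in Wm; have {}Wm := Wm isT.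
split=> [t|].
  rewrite !(tnth_nth 0) /= nth_rcons size_tuple; case: ltnP => [ltm|letm].
    by have := g1 (Ordinal ltm); rewrite !(tnth_nth 0).
  rewrite (_ : nat_of_ord t = m) ?eqxx; last first.
    by apply/eqP; rewrite eqn_leq letm -ltnS ltn_ord.
  by rewrite /greedy_sign; case: ifP => _; [right|left].
rewrite (sum_tnth_rcons *%R) (sum_tnth_rcons (fun u _ => u) x _ y) -/s.
apply: (le_trans IHW); rewrite -addrA lerD2l /greedy_sign.
(* If the sign 1 fails, -1 succeeds: by [Wm], the values [y + W _ (s + 1)] and [- y + W _ (s - 1)]
   average to at least [W (T - m) s]. *)
case: ifP => [|/negbT]; first by rewrite mul1r.
by rewrite -ltNge mulN1r => ?; lra.
Qed.

Lemma greedy_adversary_potential :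
  let x := alg_moves a greedy_adversary in
  let g := adv_moves a greedy_adversary in
  (forall t : 'I_T, tnth g t = -1 \/ tnth g t = 1) /\
  W T 0 <= \sum_(t < T) tnth g t * tnth x t + W 0 (\sum_(t < T) tnth g t).
Proof. by have := greedy_moves_potential (leqnn T); rewrite subnn. Qed.

End Game.

(** * Taylor bounds for the exponential and for quotients of normal densities *)

Section Expansion.
Variable R : realType.
Implicit Types (x u d q p X E : R).

(** The remainder is a tail of the series, and (m + i)! >= i! bounds its terms by [|x|^m] times
    those of the series of [expR |x|]. *)
Lemma expR_taylor x m :
  `|expR x - \sum_(0 <= k < m) x ^+ k / k`!%:R| <= `|x| ^+ m * expR `|x|.
Proof.
have cx := is_cvg_series_exp_coeff x.
have cabs := is_cvg_series_exp_coeff `|x|.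
have bound n : (m <= n)%N ->
    `|series (exp_coeff x) n - \sum_(0 <= k < m) x ^+ k / k`!%:R|
    <= `|x| ^+ m * expR `|x|.
  move=> lemn; rewrite /series /= (@big_cat_nat _ _ _ m)//= addrAC subrr add0r.
  apply: (le_trans (ler_norm_sum _ _ _)).
  rewrite -[X in \sum_(X <= _ < _) _]add0n big_addn.
  apply: (@le_trans _ _ (`|x| ^+ m * series (exp_coeff `|x|) (n - m)%N)).
    rewrite /series /= mulr_sumr; apply: ler_sum => i _.
    rewrite /exp_coeff /= normrM normrX normfV normr_nat exprD mulrA.
    rewrite [X in X / _]mulrC ler_wpM2l ?mulr_ge0 ?exprn_ge0//.
    by rewrite lef_pV2 ?posrE ?ltr0n ?fact_gt0// ler_nat leq_fact ?leq_addr.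
  rewrite ler_wpM2l ?exprn_ge0//.
  apply: nondecreasing_cvgn_le => //.
  apply: nondecreasing_series => k _ _.
  exact: exp_coeff_ge0.
have cB : series (exp_coeff x) n - \sum_(0 <= k < m) x ^+ k / k`!%:R
    @[n --> \oo] --> expR x - \sum_(0 <= k < m) x ^+ k / k`!%:R.
  by apply: cvgB; [exact: cx|exact: cvg_cst].
rewrite -(cvg_lim _ (cvg_norm cB))//; apply: limr_le.
  by apply/cvg_ex; eexists; exact: cvg_norm cB.
by exists m => // n /= /bound.
Qed.

Lemma expR_taylor2 x : `|expR x - (1 + x)| <= x ^+ 2 * expR `|x|.
Proof.
have := expR_taylor x 2; rewrite !big_nat_recr//= big_geq// real_normK ?num_real//.
by rewrite add0r expr0 expr1 !divr1.
Qed.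

(** Averaging the cubic expansions at [x] and [- x] cancels the odd terms. *)
Lemma cosh_taylor x :
  `|(expR x + expR (- x)) / 2 - (1 + x ^+ 2 / 2)| <= x ^+ 4 * expR `|x|.
Proof.
have := expR_taylor x 4; have := expR_taylor (- x) 4.
rewrite !big_nat_recr//= !big_geq// normrN add0r.
have -> : `|x| ^+ 4 = x ^+ 4.
  by rewrite (exprM _ 2 2) real_normK ?num_real// -exprM.
rewrite !expr0 !expr1 !divr1 sqrrN.
rewrite (_ : (- x) ^+ 3 = - x ^+ 3); last by ring.
rewrite !ler_norml => /andP[a1 a2] /andP[b1 b2].
rewrite (_ : (2`!%:R) = 2 :> R)// in a1 a2 b1 b2 *.
by apply/andP; split; lra.
Qed.


Lemma expR_half_le2 : expR (2^-1 : R) <= 2.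
Proof.
rewrite -[2^-1]opprK expRN -[leRHS]invrK lef_pV2 ?posrE ?expR_gt0// ?invr_gt0//.
by apply: le_trans (expR_ge1Dx _); lra.
Qed.

Lemma expR1_le4 : expR (1 : R) <= 4.
Proof.
have -> : (1 : R) = 2^-1 + 2^-1 by lra.
rewrite expRD; have := expR_half_le2; have := expR_ge0 (2^-1 : R) => ? ?; nra.
Qed.

(** Here [p] plays the factor depending on [d] alone and [X] the one involving [u]. The product of
    their first-order expansions is off only by the cross term [d ^+ 2 * u / 4]. *)
Lemma second_order_product d u p X E : 0 <= d <= 1 -> 0 <= u -> 1 <= E ->
  `|p - (1 - d / 2)| <= d ^+ 2 -> 0 <= X <= E ->
  `|X - (1 + u * d / 2)| <= (u + u ^+ 2) * d ^+ 2 * E ->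
  `|p * X - (1 + (u * d - d) / 2)| <= 2 * d ^+ 2 * (1 + u) ^+ 2 * E.
Proof.
move=> /andP[d0 d1] u0 E1 hp /andP[X0 XE] hX.
have -> : p * X - (1 + (u * d - d) / 2) = (p - (1 - d / 2)) * X +
    (1 - d / 2) * (X - (1 + u * d / 2)) - d ^+ 2 * u / 4 by field.
apply: (le_trans (ler_normB _ _)).
have h1 : `|(p - (1 - d / 2)) * X| <= d ^+ 2 * E.
  by rewrite normrM (ger0_norm X0) ler_pM.
have h2 : `|(1 - d / 2) * (X - (1 + u * d / 2))| <=
    (u + u ^+ 2) * d ^+ 2 * E.
  rewrite normrM -[leRHS]mul1r ler_pM// ger0_norm; lra.
have h3 : `|d ^+ 2 * u / 4| <= d ^+ 2 * u * E.
  rewrite ger0_norm ?mulr_ge0// ?sqr_ge0// ler_wpM2l ?mulr_ge0 ?sqr_ge0//.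
  by apply: le_trans E1; lra.
apply: (le_trans (lerD (le_trans (ler_normD _ _) (lerD h1 h2)) h3)).
have -> : d ^+ 2 * E + (u + u ^+ 2) * d ^+ 2 * E + d ^+ 2 * u * E =
  d ^+ 2 * E * (1 + 2 * u + u ^+ 2) by ring.
have -> : 2 * d ^+ 2 * (1 + u) ^+ 2 * E = d ^+ 2 * E * (2 * (1 + u) ^+ 2) by ring.
rewrite ler_wpM2l ?mulr_ge0 ?sqr_ge0 ?(le_trans _ E1)//.
by have := sqr_ge0 (1 + u); rewrite !expr2 => ?; nra.
Qed.

(* With [u = (y - s)^2 / v], [d = 1 / v] and [q = (y - s) / v], the next two
   lemmas expand the quotients by the N(s, v) density at [y] of, respectively,
   the mean of the N(s + 1, v) and N(s - 1, v) densities and the N(s, v + 1)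
   density; the two agree up to order [d^2]. *)
Lemma split_factor_taylor d u q : 0 <= d <= 1 -> q ^+ 2 = u * d -> 0 <= u ->
  `|expR (- (d / 2)) * ((expR q + expR (- q)) / 2) - (1 + (u * d - d) / 2)|
  <= 2 * d ^+ 2 * (1 + u) ^+ 2 * expR (u / 4 + 1).
Proof.
move=> d01 q2 u0; have /andP[d0 d1] := d01.
have qE : expR `|q| <= expR (u / 4 + 1).
  rewrite ler_expR.
  have : `|q| ^+ 2 = u * d by rewrite real_normK ?num_real.
  have udu : u * d <= u by rewrite ler_piMr.
  (* The slope 1/4 in [u] stays below the 1/2 of the Gaussian exponent, so decay remains after
     multiplying by the density. *)
  suff amgm (w : R) : w ^+ 2 = u * d -> w <= u / 4 + 1 by exact: amgm.
  by have := sqr_ge0 (w / 2 - 1); rewrite !expr2 => ? ?; nra.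
apply: second_order_product => //.
- by rewrite -[leLHS]expR0 ler_expR; lra.
- have := expR_taylor2 (- (d / 2)); rewrite normrN => /le_trans; apply.
  rewrite ger0_norm; last by lra.
  have : expR (d / 2) <= 2.
    by apply: le_trans expR_half_le2; rewrite ler_expR; lra.
  have := expR_ge0 (d / 2); have := sqr_ge0 d.
  by rewrite sqrrN expr_div_n !expr2 => ? ? ?; nra.
- rewrite divr_ge0 ?addr_ge0 ?expR_ge0//=; apply: le_trans qE.
  have : expR q <= expR `|q| by rewrite ler_expR ler_norm.
  have : expR (- q) <= expR `|q| by rewrite ler_expR -normrN ler_norm.
  by move=> ? ?; lra.
- rewrite -q2; apply: (le_trans (cosh_taylor _)).
  rewrite (exprM _ 2 2) q2 exprMn ler_pM ?mulr_ge0 ?exprn_even_ge0 ?expR_ge0//.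
  by rewrite ler_wpM2r ?sqr_ge0// lerDr.
Qed.

Lemma variance_factor_taylor d u : 0 <= d <= 1 -> 0 <= u ->
  `|Num.sqrt (1 / (1 + d)) * expR (u * d / (2 * (1 + d))) -
    (1 + (u * d - d) / 2)|
  <= 2 * d ^+ 2 * (1 + u) ^+ 2 * expR (u / 4 + 1).
Proof.
move=> d01 u0; have /andP[d0 d1] := d01.
have d1_gt0 : 0 < 1 + d by lra.
set r := Num.sqrt _; set t := u * d / _.
have r0 : 0 <= r by exact: sqrtr_ge0.
have r2 : r ^+ 2 * (1 + d) = 1.
  by rewrite sqr_sqrtr ?divr_ge0 ?ltW// mul1r mulVf// gt_eqF.
have tE : t * (2 * (1 + d)) = u * d.
  by rewrite /t divfK// mulf_neq0 ?gt_eqF.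
have t0 : 0 <= t by rewrite divr_ge0 ?mulr_ge0// ltW.
have tu : t <= u * d / 2 by nra.
have tu4 : t <= u / 4 by nra.
have tdiff : u * d / 2 - t <= u * d ^+ 2 / 2 by rewrite !expr2; nra.
have eE : expR t <= expR (u / 4 + 1) by rewrite ler_expR; lra.
have E1 : 1 <= expR (u / 4 + 1) by rewrite -[leLHS]expR0 ler_expR; lra.
apply: second_order_product => //.
- have [h1 h2] : 0 <= r - (1 - d / 2) /\ r - (1 - d / 2) <= d ^+ 2.
    have rhalf : 1 / 2 <= r.
      by rewrite leNgt; apply/negP => ?; move: r2; rewrite expr2; nra.
    (* A difference of squares removes the root; the cofactor of [r - (1 - d / 2)] is at least 1, so
       the right-hand side bounds it. *)
    have e : (r - (1 - d / 2)) * (r + (1 - d / 2)) * (1 + d) =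
        d ^+ 2 * (3 - d) / 4.
      transitivity (r ^+ 2 * (1 + d) - (1 - d / 2) ^+ 2 * (1 + d)); first by ring.
      by rewrite r2; field.
    have w1 : 1 <= (r + (1 - d / 2)) * (1 + d) by nra.
    rewrite -mulrA in e.
    have d2 : 0 <= d ^+ 2 * (3 - d) / 4 <= d ^+ 2.
      by have := sqr_ge0 d; move: (d ^+ 2) => D D0; apply/andP; split; nra.
    suff sandwich (x c K D : R) : x * c = K -> 1 <= c -> 0 <= K <= D ->
      0 <= x /\ x <= D by exact: sandwich e w1 d2.
    by move=> xcK c1 /andP[K0 KD]; split; nra.
  by rewrite ger0_norm.
- by rewrite expR_ge0 eE.
- have -> : expR t - (1 + u * d / 2) = (expR t - (1 + t)) - (u * d / 2 - t).
    by ring.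
  apply: (le_trans (ler_normB _ _)).
  rewrite mulrDl mulrDl addrC lerD//.
    rewrite ger0_norm ?subr_ge0//; apply: (le_trans tdiff).
    have : 0 <= u * d ^+ 2 by rewrite mulr_ge0 ?sqr_ge0.
    by move=> ?; nra.
  apply: (le_trans (expR_taylor2 _)); rewrite (ger0_norm t0).
  rewrite ler_pM ?sqr_ge0 ?expR_ge0// -exprMn ler_sqr ?nnegrE//.
    by nra.
  by rewrite mulr_ge0.
Qed.

(** The common first-order expansion cancels; 16 is two errors with factor 2, times the bound 4 on
    [expR 1]. *)
Lemma split_variance_factors_close d u q : 0 <= d <= 1 -> q ^+ 2 = u * d ->
  0 <= u ->
  `|expR (- (d / 2)) * ((expR q + expR (- q)) / 2) -
    Num.sqrt (1 / (1 + d)) * expR (u * d / (2 * (1 + d)))|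
  <= 16 * d ^+ 2 * (1 + u) ^+ 2 * expR (u / 4).
Proof.
move=> d01 q2 u0.
have := split_factor_taylor d01 q2 u0; have := variance_factor_taylor d01 u0.
move: (_ * expR (_ / (2 * _))) (expR (- (d / 2)) * _) => B A hB hA.
have AB : A - B = (A - (1 + (u * d - d) / 2)) - (B - (1 + (u * d - d) / 2)).
  by ring.
rewrite {}AB; apply: (le_trans (ler_normB _ _)); apply: (le_trans (lerD hA hB)).
have := expR1_le4; rewrite expRD.
have : 0 <= d ^+ 2 * (1 + u) ^+ 2 * expR (u / 4).
  by apply: mulr_ge0; [exact: (mulr_ge0 (sqr_ge0 _) (sqr_ge0 _))|exact: expR_ge0].
move: (d ^+ 2) ((1 + u) ^+ 2) (expR (u / 4)) (expR 1) => a b e f h hf.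
rewrite (_ : _ + _ = a * b * e * (4 * f)); last by ring.
rewrite (_ : 16 * _ * _ * _ = a * b * e * 16); last by ring.
by rewrite ler_wpM2l//; lra.
Qed.

End Expansion.

(** * Pointwise bounds for normal densities, parametrised by the variance *)

Section GaussianDensity.
Variable R : realType.
Implicit Types (s v y : R).

Local Notation gpdf v s := (normal_pdf s (Num.sqrt v)).

Lemma gpdfE v s y : 0 < v ->
  gpdf v s y = (Num.sqrt (v * pi *+ 2))^-1 * expR (- (y - s) ^+ 2 / (v *+ 2)).
Proof.
move=> v0; rewrite normal_pdfE ?gt_eqF ?sqrtr_gt0//.
by rewrite /normal_peak /normal_fun sqr_sqrtr// ltW.
Qed.

(** This density serves as dominating function: with [u = (y - s)^2 / v] it decays only like
    [expR (- (u / 8))], which leaves room for polynomial factors in [u]. *)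
Lemma gpdf_widen v s y : 0 < v ->
  gpdf (4 * v) s y =
  (Num.sqrt (v * pi *+ 2))^-1 / 2 * expR (- ((y - s) ^+ 2 / v / 8)).
Proof.
move=> v0; rewrite gpdfE ?mulr_gt0//; congr (_ * expR _); last first.
  by field; rewrite gt_eqF.
rewrite -mulrA -mulrnAr sqrtrM// invfM mulrC; congr (_ / _).
have -> : (4 : R) = 2 ^+ 2 by rewrite -natrX.
by rewrite sqrtr_sqr ger0_norm.
Qed.

Lemma linear_le_expR (x k : R) : 1 <= k -> 0 <= x -> 1 + x <= k * expR (x / k).
Proof.
move=> k1 x0; have k0 : 0 < k by lra.
apply: (@le_trans _ _ (k * (1 + x / k))).
  by rewrite mulrDr mulr1 mulrCA divff ?gt_eqF// mulr1 lerD2r.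
by rewrite ler_pM2l// expR_ge1Dx.
Qed.

Lemma norm_le_sqrt_sqr v (z : R) : 0 < v ->
  `|z| <= Num.sqrt v * (1 + z ^+ 2 / v) / 2.
Proof.
move=> v0; have t0 : 0 < Num.sqrt v by rewrite sqrtr_gt0.
rewrite -{2}(sqr_sqrtr (ltW v0)); move: (Num.sqrt v) t0 => t t0.
rewrite -(real_normK (num_real z)); move: `|z| (normr_ge0 z) => w w0.
have -> : t * (1 + w ^+ 2 / t ^+ 2) / 2 = (t ^+ 2 + w ^+ 2) / (2 * t).
  by field; rewrite gt_eqF.
rewrite ler_pdivlMr ?mulr_gt0//.
by have := sqr_ge0 (t - w); rewrite !expr2 => ?; nra.
Qed.

Lemma moment_gpdf_le v s y : 0 < v ->
  `|y - s| * gpdf v s y <= 8 * Num.sqrt v * gpdf (4 * v) s y.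
Proof.
move=> v0; rewrite gpdf_widen// gpdfE//.
set P := (Num.sqrt _)^-1; have P0 : 0 <= P by rewrite invr_ge0 sqrtr_ge0.
have := norm_le_sqrt_sqr (y - s) v0; set u := _ / v => zu.
have u0 : 0 <= u by rewrite divr_ge0 ?sqr_ge0 ?ltW.
have -> : - (y - s) ^+ 2 / (v *+ 2) = - (u / 2).
  by rewrite /u; field; rewrite gt_eqF.
(* Rate 1/8 suffices for one factor [1 + u], since u/8 - u/2 <= - u/8. *)
have := linear_le_expR (ltac:(lra) : 1 <= (8 : R)) u0 => u8.
have t0 := sqrtr_ge0 v.
apply: (@le_trans _ _ (Num.sqrt v * (8 * expR (u / 8)) / 2 *
    (P * expR (- (u / 2))))).
  rewrite ler_wpM2r ?mulr_ge0 ?expR_ge0//; apply: (le_trans zu).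
  by rewrite ler_wpM2r ?ler_wpM2l.
have e : expR (u / 8) * expR (- (u / 2)) <= expR (- (u / 8)).
  by rewrite -expRD ler_expR; lra.
rewrite [leLHS](_ : _ =
  8 * Num.sqrt v * P / 2 * (expR (u / 8) * expR (- (u / 2)))); last by field.
rewrite [leRHS](_ : _ = 8 * Num.sqrt v * P / 2 * expR (- (u / 8))).
  by rewrite ler_wpM2l// divr_ge0// mulr_ge0// mulr_ge0.
by field.
Qed.

(** With the N(s, v) density factored out, what remains is the comparison of quotients at
    [d = 1 / v]. The weight [|y - s|] costs [Num.sqrt v] and one more factor [1 + u]. *)
Lemma split_gpdf_close v s y : 1 <= v ->
  `|y - s| * `|(gpdf v (s + 1) y + gpdf v (s - 1) y) / 2 - gpdf (v + 1) s y|
  <= 16 * 24 ^+ 3 * (Num.sqrt v / v ^+ 2) * gpdf (4 * v) s y.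
Proof.
move=> v1; have v0 : 0 < v by lra.
have v_neq0 : v != 0 by rewrite gt_eqF.
rewrite gpdf_widen// !gpdfE ?addr_gt0//.
set P := (Num.sqrt (v * pi *+ 2))^-1.
have P0 : 0 <= P by rewrite invr_ge0 sqrtr_ge0.
have := norm_le_sqrt_sqr (y - s) v0; set u := _ / v => zu.
have u0 : 0 <= u by rewrite divr_ge0 ?sqr_ge0 ?ltW.
pose d := v^-1; pose q := (y - s) / v.
have d01 : 0 <= d <= 1 by rewrite invr_ge0 (ltW v0) invf_le1.
have q2 : q ^+ 2 = u * d by rewrite /q /u /d; field.
have close := split_variance_factors_close d01 q2 u0.
have -> : - (y - (s + 1)) ^+ 2 / (v *+ 2) = - (u / 2) + (- (d / 2) + q).
  by rewrite /u /d /q; field.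
have -> : - (y - (s - 1)) ^+ 2 / (v *+ 2) = - (u / 2) + (- (d / 2) - q).
  by rewrite /u /d /q; field.
have -> : - (y - s) ^+ 2 / ((v + 1) *+ 2) = - (u / 2) + u * d / (2 * (1 + d)).
  rewrite /u /d; field; rewrite v_neq0 /= ?gt_eqF//; lra.
have -> : (Num.sqrt ((v + 1) * pi *+ 2))^-1 = P * Num.sqrt (1 / (1 + d)).
  have /andP[d0 _] := d01; rewrite div1r sqrtrV ?addr_ge0// /P -invfM -sqrtrM.
    by congr (Num.sqrt _)^-1; rewrite /d; field.
  by rewrite mulrn_wge0// mulr_ge0 ?pi_ge0 ?ltW.
set A := expR (- (d / 2)) * _ in close; set B := Num.sqrt _ * _ in close.
rewrite !(expRD (- (u / 2))) !(expRD (- (d / 2))).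
rewrite [X in _ * `|X|](_ : _ = P * expR (- (u / 2)) * (A - B)); last first.
  by rewrite /A /B; field.
rewrite normrM (ger0_norm (mulr_ge0 P0 (expR_ge0 _))).
(* Three factors [1 + u] at rate 1/24 cost [expR (u / 8)], exactly the gap between the available
   exponent - u/2 + u/4 and the target - u/8. *)
have u24 := linear_le_expR (ltac:(lra) : 1 <= (24 : R)) u0.
have t0 := sqrtr_ge0 v.
apply: (@le_trans _ _ (Num.sqrt v * (1 + u) / 2 * (P * expR (- (u / 2)) *
    (16 * d ^+ 2 * (1 + u) ^+ 2 * expR (u / 4))))).
  rewrite ler_pM ?mulr_ge0 ?expR_ge0//.
  by rewrite ler_wpM2l ?mulr_ge0 ?expR_ge0.
rewrite [leLHS](_ : _ = 8 * (Num.sqrt v * d ^+ 2) * P *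
   ((1 + u) ^+ 3 * (expR (- (u / 2)) * expR (u / 4)))); last by field.
rewrite [leRHS](_ : _ = 8 * (Num.sqrt v * d ^+ 2) * P *
   (24 ^+ 3 * expR (- (u / 8)))); last by rewrite /d; field.
have /andP[d0 _] := d01; rewrite ler_wpM2l ?mulr_ge0//.
rewrite (_ : expR (- (u / 8)) =
    expR (u / 24) ^+ 3 * (expR (- (u / 2)) * expR (u / 4))).
  rewrite mulrA ler_wpM2r ?mulr_ge0 ?expR_ge0// -exprMn.
  by rewrite lerXn2r ?nnegrE ?mulr_ge0 ?expR_ge0// addr_ge0.
by rewrite -expRM_natl -!expRD; congr expR; field.
Qed.

(** A telescoping majorant of v^(-3/2). With a, b the roots of v and v + 1, 1/a - 1/b = 1 / (a b (a
    + b)), and b <= 2a gives b (a + b) <= 6 a^2. *)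
Lemma inv_three_half_power_le v : 1 <= v ->
  Num.sqrt v / v ^+ 2 <= 6 * ((Num.sqrt v)^-1 - (Num.sqrt (v + 1))^-1).
Proof.
move=> v1; have v0 : 0 <= v by lra.
have a1 : 1 <= Num.sqrt v by rewrite -[leLHS]sqrtr1 ler_wsqrtr.
have b2 : Num.sqrt (v + 1) ^+ 2 = Num.sqrt v ^+ 2 + 1.
  by rewrite !sqr_sqrtr// addr_ge0.
suff bound (a b : R) : 1 <= a -> 0 <= b -> b ^+ 2 = a ^+ 2 + 1 ->
    a / (a ^+ 2) ^+ 2 <= 6 * (a^-1 - b^-1).
  by have := bound _ _ a1 (sqrtr_ge0 _) b2; rewrite sqr_sqrtr.
move=> {}a1 b0 {}b2.
have a0 : 0 <= a by lra.
have ab : a <= b by rewrite -ler_sqr// b2 lerDl.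
have b2a : b <= 2 * a by rewrite -ler_sqr ?nnegrE ?mulr_ge0// exprMn b2; nra.
have diff : (b - a) * (a + b) = 1 by rewrite [a + b]addrC -subr_sqr b2 addrAC subrr add0r.
have -> : a / (a ^+ 2) ^+ 2 = (b - a) * (a + b) / a ^+ 3.
  by rewrite diff; field; lra.
have -> : 6 * (a^-1 - b^-1) = 6 * (b - a) / (a * b).
  by field; apply/andP; split; lra.
have a_gt0 : 0 < a by lra.
have b_gt0 : 0 < b by lra.
rewrite ler_pdivrMr ?exprn_gt0//.
rewrite mulrAC ler_pdivlMr ?mulr_gt0//.
rewrite [leLHS](_ : _ = (b - a) * a * ((a + b) * b)); last by ring.
rewrite [leRHS](_ : _ = (b - a) * a * (6 * a ^+ 2)); last by ring.
rewrite ler_wpM2l//; first by rewrite mulr_ge0; lra.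
by rewrite expr2; nra.
Qed.

End GaussianDensity.

(** * Gaussian means of Lipschitz functions *)

Section GaussianMean.
Variable R : realType.
Implicit Types (s v y C : R) (f : R -> R).

Local Notation mu := (@lebesgue_measure R).
Local Notation gpdf v s := (normal_pdf s (Num.sqrt v)).

(** This is E h(s + sqrt v Z), with [s] and [v] entering through the density only, so that means are
    compared by comparing densities. *)
Definition gauss_mean (h : R -> R) v s : R := \int[mu]_y (h y * gpdf v s y).

Lemma integrable_scaled_gpdf C v s :
  mu.-integrable setT (EFin \o (fun y => C * gpdf v s y)).
Proof.
rewrite (_ : _ \o _ = (fun y => C%:E * (gpdf v s y)%:E)%E); last first.
  by apply/funext => y; rewrite /= EFinM.
by apply: integrableZl => //; exact: integrable_normal_pdf.
Qed.

Lemma integrable_dominated_gpdf f C v s : measurable_fun setT f ->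
  (forall y, `|f y| <= C * gpdf v s y) -> mu.-integrable setT (EFin \o f).
Proof.
move=> mf fC; apply: (@le_integrable _ _ _ mu _ measurableT _
  (EFin \o (fun y => C * gpdf v s y))).
- exact/measurable_EFinP.
- by move=> y _; rewrite /= lee_fin (le_trans (fC y)) ?ler_norm.
- exact: integrable_scaled_gpdf.
Qed.

Lemma Rintegral_gpdf v s : \int[mu]_y gpdf v s y = 1.
Proof. by rewrite /Rintegral integral_normal_pdf. Qed.

(** The dominating density has mass one, so pointwise bounds pass to integrals with the same
    constant. *)
Lemma normr_Rintegral_le_gpdf f C v s : measurable_fun setT f ->
  (forall y, `|f y| <= C * gpdf v s y) -> `|\int[mu]_y f y| <= C.
Proof.
move=> mf fC.
have intf := integrable_dominated_gpdf mf fC.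
apply: le_trans (le_normr_Rintegral measurableT intf) _.
rewrite -[leRHS]mulr1 -(Rintegral_gpdf v s) -RintegralZl//; last first.
  exact: integrable_normal_pdf.
apply: le_Rintegral => //; first exact: integrable_norm.
exact: integrable_scaled_gpdf.
Qed.

Lemma Rintegral_half_sum_sub f g k :
  mu.-integrable setT (EFin \o f) -> mu.-integrable setT (EFin \o g) ->
  mu.-integrable setT (EFin \o k) ->
  mu.-integrable setT (EFin \o (fun y => (f y + g y) / 2 - k y)) /\
  \int[mu]_y ((f y + g y) / 2 - k y) =
  (\int[mu]_y f y + \int[mu]_y g y) / 2 - \int[mu]_y k y.
Proof.
move=> intf intg intk.
have intfg : mu.-integrable setT (EFin \o (fun y => f y + g y)).
  exact: (integrableD measurableT intf intg).
have intfg2 : mu.-integrable setT (EFin \o (fun y => (f y + g y) / 2)).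
  exact: (integrableZr measurableT 2^-1 intfg).
split; first exact: (integrableB measurableT intfg2 intk).
by rewrite RintegralB// RintegralZr// RintegralD.
Qed.

Variable h : R -> R.
Hypothesis h_lip : forall x y, `|h x - h y| <= `|x - y|.

Lemma lip1_continuous : continuous h.
Proof.
move=> x; apply/cvgrPdist_le => e e0; near=> y.
apply: le_trans (h_lip _ _) _.
near: y; apply: cvgr_dist_le => //; exact: cvg_id.
Unshelve. all: by end_near. Qed.

Lemma lip1_measurable : measurable_fun setT h.
Proof. exact: continuous_measurable_fun lip1_continuous. Qed.

Lemma deviation_gpdf_le v s y : 0 < v ->
  `|(h y - h s) * gpdf v s y| <= 8 * Num.sqrt v * gpdf (4 * v) s y.
Proof.
move=> v0; apply: le_trans (moment_gpdf_le _ _ v0).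
rewrite normrM (ger0_norm (normal_pdf_ge0 _ _ _)).
by rewrite ler_wpM2r ?normal_pdf_ge0.
Qed.

Lemma measurable_deviation_gpdf v s :
  measurable_fun setT (fun y => (h y - h s) * gpdf v s y).
Proof.
apply: measurable_funM; last exact: measurable_normal_pdf.
by apply: measurable_funB => //; exact: lip1_measurable.
Qed.

Lemma integrable_lip1_gpdf v s : 0 < v ->
  mu.-integrable setT (EFin \o (fun y => h y * gpdf v s y)).
Proof.
move=> v0.
have -> : EFin \o (fun y => h y * gpdf v s y) =
    ((fun y => ((h y - h s) * gpdf v s y)%R%:E) \+
     (EFin \o (fun y => h s * gpdf v s y)%R))%E.
  by apply/funext => y /=; rewrite -EFinD; congr EFin; ring.
apply: integrableD => //.
  apply: integrable_dominated_gpdf => [|y]; last exact: deviation_gpdf_le.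
  exact: measurable_deviation_gpdf.
exact: integrable_scaled_gpdf.
Qed.

Lemma gauss_mean_close v s : 0 < v -> `|gauss_mean h v s - h s| <= 8 * Num.sqrt v.
Proof.
move=> v0.
have -> : gauss_mean h v s - h s = \int[mu]_y ((h y - h s) * gpdf v s y).
  rewrite -[X in _ - X]mulr1 -(Rintegral_gpdf v s) -RintegralZl//; last first.
    exact: integrable_normal_pdf.
  rewrite -RintegralB//; first by apply: eq_Rintegral => y _ /=; ring.
    exact: integrable_lip1_gpdf.
  exact: integrable_scaled_gpdf.
apply: normr_Rintegral_le_gpdf => [|y]; last exact: deviation_gpdf_le.
exact: measurable_deviation_gpdf.
Qed.

Definition split_error : R := 16 * 24 ^+ 3.

(* The averaged split density minus the wider one has integral zero, so [h s] may
   be subtracted from [h] before taking absolute values. *)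
Lemma gauss_mean_split v s : 1 <= v ->
  gauss_mean h (v + 1) s - split_error * (Num.sqrt v / v ^+ 2) <=
  (gauss_mean h v (s + 1) + gauss_mean h v (s - 1)) / 2.
Proof.
move=> v1; have v0 : 0 < v by lra.
pose D y := (gpdf v (s + 1) y + gpdf v (s - 1) y) / 2 - gpdf (v + 1) s y.
have mD : measurable_fun setT D.
  apply: measurable_funB; last exact: measurable_normal_pdf.
  apply: measurable_funM => //.
  by apply: measurable_funD; exact: measurable_normal_pdf.
have eq_dev : (gauss_mean h v (s + 1) + gauss_mean h v (s - 1)) / 2
    - gauss_mean h (v + 1) s = \int[mu]_y ((h y - h s) * D y).
  have inth w m : 0 < w -> _ := @integrable_lip1_gpdf w m.
  have [int1 int1E] := Rintegral_half_sum_sub (inth v (s + 1) v0)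
    (inth v (s - 1) v0) (inth (v + 1) s (addr_gt0 v0 ltr01)).
  have intc w m := integrable_scaled_gpdf (h s) w m.
  have [int2 int2E] :=
    Rintegral_half_sum_sub (intc v (s + 1)) (intc v (s - 1)) (intc (v + 1) s).
  transitivity (\int[mu]_y (((h y * gpdf v (s + 1) y + h y * gpdf v (s - 1) y) / 2
      - h y * gpdf (v + 1) s y) -
    ((h s * gpdf v (s + 1) y + h s * gpdf v (s - 1) y) / 2
      - h s * gpdf (v + 1) s y))).
    rewrite RintegralB// int1E int2E !RintegralZl//; try exact: integrable_normal_pdf.
    rewrite !Rintegral_gpdf -!/(gauss_mean h _ _).
    rewrite [X in _ = _ - X](_ : _ = 0) ?subr0//.
    by rewrite mulr1; field.
  by apply: eq_Rintegral => y _; rewrite /D; field.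
suff : `|\int[mu]_y ((h y - h s) * D y)| <= split_error * (Num.sqrt v / v ^+ 2).
  rewrite -eq_dev ler_norml => /andP[+ _].
  by rewrite lerBrDr addrC.
apply: (@normr_Rintegral_le_gpdf _ _ (4 * v) s) => [|y].
  apply: measurable_funM => //.
  by apply: measurable_funB => //; exact: lip1_measurable.
apply: le_trans (split_gpdf_close _ _ v1).
by rewrite normrM ler_wpM2r.
Qed.

End GaussianMean.

(** * From the standard normal law to Lebesgue integrals against densities *)

Section NormalExpectation.
Variable R : realType.

Local Notation mu := (@lebesgue_measure R).
Local Notation gpdf v s := (normal_pdf s (Num.sqrt v)).

(** The Radon-Nikodym derivative and the density have equal integrals over every measurable set,
    hence agree almost everywhere. *)
Lemma ge0_integral_normal_prob (m s : R) (f : R -> \bar R) :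
  measurable_fun setT f -> (forall x, 0 <= f x)%E ->
  (\int[normal_prob m s]_x f x = \int[mu]_x (f x * (normal_pdf m s x)%:E))%E.
Proof.
move=> mf f0; have dom := normal_prob_dominates m s.
rewrite -(Radon_Nikodym_SigmaFinite.change_of_variables dom f0 measurableT mf).
have int_pdf := integrable_normal_pdf m s.
have int_RN := Radon_Nikodym_SigmaFinite.f_integrable dom.
apply: ae_eq_integral => //.
- by apply: emeasurable_funM => //; exact: measurable_int int_RN.
- by apply: emeasurable_funM => //; exact: measurable_int int_pdf.
apply: ae_eqe_mul2l; apply: integral_ae_eq => //.
  exact: measurable_int int_pdf.
move=> E _ mE.
by rewrite -(Radon_Nikodym_SigmaFinite.f_integral dom).
Qed.

Lemma ge0_integral_scaled_normal (v : R) (f : R -> R) : 0 < v -> continuous f ->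
  (forall x, 0 <= f x) ->
  (\int[normal_prob 0 1]_z (f (Num.sqrt v * z))%:E =
   \int[mu]_y (f y * gpdf v 0 y)%:E)%E.
Proof.
move=> v0 cf f0; have t0 : 0 < Num.sqrt v by rewrite sqrtr_gt0.
pose F : R -> R := fun z => Num.sqrt v * z.
have dF (x : R^o) : is_derive x 1 F (Num.sqrt v).
  by rewrite /F; apply: is_derive_eq; rewrite scaler1.
have F'E : F^`()%classic = cst (Num.sqrt v).
  by apply/funext => x; rewrite derive1E derive_val.
have cF : continuous F by move=> x; apply: cvgM; [exact: cvg_cst|exact: cvg_id].
rewrite ge0_integral_normal_prob; last 2 first.
- apply/measurable_EFinP; apply: continuous_measurable_fun => x.
  by apply: continuous_comp; [exact: cF|exact: cf].
- by move=> z; rewrite lee_fin.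
rewrite (@increasing_ge0_integration_by_substitutionT _ F
    (fun y => f y * gpdf v 0 y)).
- apply: eq_integral => z _; rewrite -EFinM F'E /=; congr EFin.
  rewrite -mulrA; congr (_ * _).
  (* The Jacobian [Num.sqrt v] turns the N(0, v) density at [Num.sqrt v * z] into the standard
     density at [z]. *)
  rewrite -[RHS]/(gpdf v 0 (Num.sqrt v * z) * Num.sqrt v) -{1}sqrtr1 !gpdfE//.
  rewrite !subr0 mul1r -mulrnAr sqrtrM ?ltW// invfM exprMn sqr_sqrtr ?ltW//.
  rewrite (_ : - (v * z ^+ 2) / (v *+ 2) = - z ^+ 2 / 2); last first.
    by field; rewrite gt_eqF.
  by move: (Num.sqrt (pi *+ 2))^-1 => P; field; rewrite gt_eqF.
- by move=> x y xy; rewrite /F ltr_pM2l.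
- by rewrite F'E => ?; exact: cvg_cst.
- by rewrite F'E; exact: is_cvg_cst.
- by rewrite F'E; exact: is_cvg_cst.
- by move=> x; have [] := dF x.
- by apply/gt0_cvgMrNy => //; exact: cvg_id.
- by apply/gt0_cvgMry => //; exact: cvg_id.
- move=> x; apply: cvgM; first exact: cf.
  by apply: continuous_normal_pdf; rewrite gt_eqF.
- by move=> x; rewrite mulr_ge0 ?normal_pdf_ge0.
Qed.

End NormalExpectation.

(** * The corrected potential and the final bound *)

Section Potential.
Variable R : realType.

Local Notation mu := (@lebesgue_measure R).
Local Notation gpdf v s := (normal_pdf s (Num.sqrt v)).

(** The substitution is made for nonnegative integrands, so [h] is split into positive and negative
    parts, the latter being the positive part of [- h]. *)
Lemma expectation_scaled_normal (h : R -> R) (v : R) :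
  (forall x y, `|h x - h y| <= `|x - y|) -> 0 < v ->
  ('E_(normal_prob 0 1)[fun z : R => (h (Num.sqrt v * z))%R] =
   (gauss_mean h v 0)%:E)%E.
Proof.
move=> h_lip v0; rewrite unlock.
rewrite /gauss_mean /Rintegral fineK; last first.
  exact: integrable_fin_num (integrable_lip1_gpdf h_lip 0 v0).
have ch := lip1_continuous h_lip.
have gE (k : R -> R) y : ((fun y => (k y * gpdf v 0 y)%:E)^\+ y =
    (Num.max (k y) 0 * gpdf v 0 y)%:E)%E.
  rewrite funeposE -[0%E]/(0%:E) -EFin_max; congr EFin.
  by rewrite maxr_pMl ?normal_pdf_ge0// mul0r.
have half (k : R -> R) : continuous k ->
    (\int[normal_prob 0 1]_z (fun z => (k (Num.sqrt v * z))%:E)^\+ z =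
     \int[mu]_y (fun y => (k y * gpdf v 0 y)%:E)^\+ y)%E.
  move=> ck; under [RHS]eq_integral do rewrite gE.
  rewrite -(@ge0_integral_scaled_normal _ v (fun y => Num.max (k y) 0))//.
  - by apply: eq_integral => z _; rewrite funeposE EFin_max.
  - by move=> x; apply: continuous_max; [exact: ck|exact: cvg_cst].
  - by move=> x; rewrite le_max lexx orbT.
rewrite [LHS]integralE [RHS]integralE half//; congr (_ - _)%E.
have cNh : continuous (fun y => - h y).
  by move=> y; apply: cvgN; exact: ch.
transitivity (\int[normal_prob 0 1]_z
    (fun z => (- h (Num.sqrt v * z))%:E)^\+ z)%E.
  by apply: eq_integral => z _; rewrite funenegE funeposE EFinN.
rewrite (half (fun y => - h y))//.
by apply: eq_integral => y _; rewrite funenegE funeposE mulNr EFinN.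
Qed.

(* The extra term [6 * split_error / sqrt n] telescopes the splitting errors, of
   order [n^(-3/2)]; [9] covers the last round, where no smoothing is left. *)
Definition potential (h : R -> R) (n : nat) (s : R) : R :=
  if n is 0 then h s + 9 + 6 * split_error R
  else gauss_mean h n%:R s + 6 * split_error R / Num.sqrt n%:R.

Lemma potential_step (h : R -> R) n s :
  (forall x y, `|h x - h y| <= `|x - y|) ->
  potential h n.+1 s <= (potential h n (s + 1) + potential h n (s - 1)) / 2.
Proof.
move=> h_lip; case: n => [|n] /=.
  (* Last round: 8 comes from undoing the smoothing of variance 1, and 1 more from moving [s] to
     [s + 1] or [s - 1]. *)
  have := gauss_mean_close h_lip s ltr01; rewrite sqrtr1 divr1 mulr1.
  have := h_lip s (s + 1); have := h_lip s (s - 1).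
  have -> : s - (s - 1) = 1 by ring.
  have -> : s - (s + 1) = - 1 by ring.
  rewrite normrN normr1 !ler_norml.
  move: (gauss_mean h 1 s) (split_error R) => G K.
  by move=> /andP[? ?] /andP[? ?] /andP[? ?]; lra.
have n1 : (1 : R) <= n.+1%:R by rewrite ler1n.
rewrite -natr1.
(* [K * e] is the splitting error; [p] and [q] are the inverse roots of n + 1 and n + 2. The
   correction changes by [6 * K * (p - q)], which pays for it. *)
suff arith (K e p q G G1 G2 : R) : 0 <= K -> e <= 6 * (p - q) ->
    G - K * e <= (G1 + G2) / 2 ->
    G + 6 * K * q <= (G1 + 6 * K * p + (G2 + 6 * K * p)) / 2.
  apply: arith (inv_three_half_power_le n1) (gauss_mean_split h_lip s n1).
  by rewrite /split_error.
move=> K0 e_le G_le.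
have : K * e <= K * (6 * (p - q)) by rewrite ler_wpM2l.
by move=> ?; lra.
Qed.

End Potential.

Theorem theorem4 (R : realType) :
  exists c : R, 0 < c /\
    forall (T : nat), (1 <= T)%N ->
    forall (a : olo_algorithm R T) (h : R -> R), 1.-lipschitz h ->
    exists l : adversary R T,
      let x := alg_moves a l in
      let g := adv_moves a l in
      (forall t : 'I_T, tnth g t = -1 \/ tnth g t = 1) /\
      ((\sum_(t < T) tnth g t * tnth x t)%:E >
         (- h (\sum_(t < T) tnth g t))%:E
         + 'E_(normal_prob 0 1)[fun z : R => (h (Num.sqrt T%:R * z))%R] - c%:E)%E.
Proof.
pose K := split_error R; have K0 : 0 <= K by rewrite /K /split_error.
(* The final potential exceeds [h] by [9 + 6 * K]; the extra 1 makes the inequality strict. *)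
exists (10 + 6 * K); split=> [|T T1 a h h_lip]; first lra.
have {}h_lip x y : `|h x - h y| <= `|x - y|.
  by have := h_lip (x, y) (conj Logic.I Logic.I); rewrite /= mul1r.
have [g1 Wl] :=
  greedy_adversary_potential a (fun n s _ => potential_step n s h_lip).
exists (greedy_adversary a (potential h)); split=> //.
rewrite expectation_scaled_normal ?ltr0n//.
rewrite -EFinN -!EFinD lte_fin.
suff arith (S P G e : R) : 0 <= e -> G + e <= P + (S + 9 + 6 * K) ->
    - S + G - (10 + 6 * K) < P.
  apply: (arith _ _ _ (6 * K / Num.sqrt T%:R)).
    by rewrite divr_ge0 ?sqrtr_ge0 ?mulr_ge0.
  (* [1 <= T] selects the Gaussian branch of [potential] at the start of the game. *)
  by apply: le_trans Wl; case: (T) T1.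
by move=> e0 le_P; lra.
Qed.
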